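(* Let $s<\frac12$ and $1\le p<\infty$. Then, for either choice of the sign $\pm$, the data-to-solution map for the second renormalized mKdV equation (mKdV2) $$\partial_tu+\partial_x^3u=\pm\Big(|u|^2\partial_xu-\Big(\frac1{2\pi}\int_{\mathbb T}|u|^2\,dx\Big)\partial_xu-i\Big(\frac1{2\pi}\int_{\mathbb T}\mathrm{Im}(\overline u\,\partial_xu)\,dx\Big)u\Big),\qquad u|_{t=0}=u_0,$$ on $\mathbb R\times\mathbb T$ (complex-valued) fails to be locally uniformly continuous in $C(\mathbb R;\mathcal FL^{s,p}(\mathbb T))$.
   Context: $\mathbb T=\mathbb R/(2\pi\mathbb Z)$, $\langle n\rangle=(1+n^2)^{1/2}$, $\hat f(n)=\frac1{2\pi}\int_{\mathbb T}f(x)e^{-inx}\,dx$, and $\|f\|_{\mathcal FL^{s,p}}=\|\langle n\rangle^s\hat f(n)\|_{\ell^p_n(\mathbb Z)}$. The data-to-solution map sends smooth data $u_0\in C^\infty(\mathbb T)$ to the corresponding smooth global solution $u$. Failure of local uniform continuity means: for every $T>0$, there is a set $B\subset C^\infty(\mathbb T)$, bounded in $\mathcal FL^{s,p}(\mathbb T)$, on which the map $u_0\mapsto u$ is not uniformly continuous from the $\mathcal FL^{s,p}(\mathbb T)$-metric to the metric of $C([-T,T];\mathcal FL^{s,p}(\mathbb T))$. *)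

(* Defs.v *)
From Stdlib Require Import Reals ZArith List ClassicalEpsilon.
From Coquelicot Require Import Coquelicot.
Open Scope R_scope.

(* Functions on T = R/(2 pi Z) are 2 pi-periodic functions on R; a function u
   on R x T is curried, with time first. *)

Definition periodic (f : R -> C) : Prop := forall x, f (x + 2 * PI) = f x.

Definition mean (f : R -> R) : R := / (2 * PI) * RInt f 0 (2 * PI).

Definition deriv (f : R -> C) (x : R) : C :=
  (Derive (fun y => Re (f y)) x, Derive (fun y => Im (f y)) x).

Definition smooth (f : R -> C) : Prop :=
  forall (k : nat) (x : R),
    ex_derive (V := C_R_NormedModule) (Nat.iter k deriv f) x.

(* C^infty(T) *)
Definition smooth_on_T (f : R -> C) : Prop := periodic f /\ smooth f.

Definition dt (u : R -> R -> C) (t x : R) : C := deriv (fun t' => u t' x) t.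

Definition dx (u : R -> R -> C) (t x : R) : C := deriv (u t) x.

(* The partial derivative of u along a word in {dt, dx}; true stands for dt. *)
Definition partial (w : list bool) (u : R -> R -> C) : R -> R -> C :=
  fold_right (fun (b : bool) v => if b then dt v else dx v) u w.

(* Joint smoothness: partial derivatives of every order, taken in any order of
   the variables, exist and are jointly continuous. *)
Definition smooth2 (u : R -> R -> C) : Prop :=
  forall (w : list bool) (t x : R),
    let v := partial w u in
    ex_derive (V := C_R_NormedModule) (fun t' => v t' x) t /\
    ex_derive (V := C_R_NormedModule) (v t) x /\
    continuous (T := prod_UniformSpace R_UniformSpace R_UniformSpace)
      (U := C_R_NormedModule) (fun z => v (fst z) (snd z)) (t, x).

Definition smooth_on_RxT (u : R -> R -> C) : Prop :=
  (forall t, periodic (u t)) /\ smooth2 u.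

Definition expi (y : R) : C := (cos y, sin y).

Definition fourier (f : R -> C) (n : Z) : C :=
  (RtoC (/ (2 * PI)) *
   RInt (V := C_R_CompleteNormedModule)
     (fun x => f x * expi (- (IZR n * x)))%C 0 (2 * PI))%C.

(* x^y for 0 <= x and 0 < y; Stdlib has Rpower 0 y = 1. *)
Definition rpow (x y : R) : R := if Req_EM_T x 0 then 0 else Rpower x y.

(* The sum over Z of a nonnegative family, with value p_infty if it diverges:
   the N-th partial sum ranges over -(N+1) <= n <= N. *)
Definition sumZ (a : Z -> R) : Rbar :=
  Lim_seq (fun N => sum_n (fun k => a (Z.of_nat k)) N
                    + sum_n (fun k => a (- Z.of_nat (S k))%Z) N).

Definition lp_norm (p : R) (a : Z -> R) : Rbar :=
  match sumZ (fun n => rpow (Rabs (a n)) p) with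
  | Finite r => Finite (rpow r (/ p))
  | _ => p_infty
  end.

Definition japanese (n : Z) : R := sqrt (1 + (IZR n) ^ 2).

Definition FL_norm (s p : R) (f : R -> C) : Rbar :=
  lp_norm p (fun n => Rpower (japanese n) s * Cmod (fourier f n)).

Definition FL_dist (s p : R) (f g : R -> C) : Rbar :=
  FL_norm s p (fun x => f x - g x)%C.

(* The metric of C([-T,T]; FL^{s,p}) *)
Definition CFL_dist (T s p : R) (u v : R -> R -> C) : Rbar :=
  Rbar_lub (fun d => exists t, - T <= t <= T /\ d = FL_dist s p (u t) (v t)).

Definition mKdV2 (sgn : R) (u : R -> R -> C) : Prop :=
  forall t x,
    (dt u t x + dx (dx (dx u)) t x =
     RtoC sgn *
       (RtoC (Cmod (u t x) ^ 2) * dx u t x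
        - RtoC (mean (fun y => (Cmod (u t y) ^ 2)%R)) * dx u t x
        - Ci * RtoC (mean (fun y => Im (Cconj (u t y) * dx u t y))) * u t x))%C.

Definition smooth_global_solution
    (sgn : R) (u0 : R -> C) (u : R -> R -> C) : Prop :=
  smooth_on_RxT u /\ mKdV2 sgn u /\ (forall x, u 0 x = u0 x).

(* The data-to-solution map: for u0 in C^infty(T), the (unique) smooth global
   solution with data u0, selected by Hilbert's epsilon. *)
Definition solution_map (sgn : R) (u0 : R -> C) : R -> R -> C :=
  epsilon (inhabits (fun _ _ => RtoC 0)) (smooth_global_solution sgn u0).

Definition FL_bounded (s p : R) (B : (R -> C) -> Prop) : Prop :=
  exists M : R, forall f, B f -> Rbar_le (FL_norm s p f) M.

Definition uniformly_continuous_on (T s p : R) (B : (R -> C) -> Prop)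
    (Phi : (R -> C) -> (R -> R -> C)) : Prop :=
  forall eps : R, 0 < eps -> exists delta : R, 0 < delta /\
    forall f g, B f -> B g ->
      Rbar_lt (FL_dist s p f g) delta ->
      Rbar_lt (CFL_dist T s p (Phi f) (Phi g)) eps.

Definition fails_locally_uniformly_continuous (s p : R)
    (Phi : (R -> C) -> (R -> R -> C)) : Prop :=
  forall T : R, 0 < T ->
    exists B : (R -> C) -> Prop,
      (forall f, B f -> smooth_on_T f) /\
      FL_bounded s p B /\
      ~ uniformly_continuous_on T s p B Phi.

(* Main.v *)
Require Import Defs.
From Stdlib Require Import Reals ZArith List ClassicalEpsilon FunctionalExtensionality Lra Lia.
From Coquelicot Require Import Coquelicot.
Open Scope R_scope.

(** Single-mode data have explicit solutions. If [u] is the plane wave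
    [z e^{i(kx + om t)}], then [|u|^2] is constant, so the cubic term cancels
    against the mass term, and the momentum term, which acts as the constant
    frequency [k |z|^2], is left: [u] solves the equation when
    [om = k^3 - sgn k |z|^2]. The phase velocity thus depends on the amplitude.

    Let two waves have the same frequency [k = j] and amplitudes [r] and [r q],
    where [r = <j>^{-s}] and [q^2 = 1 + eta]. In [FL^{s,p}] the data have norms
    [1] and [q] and lie at distance [q - 1 < eta]. Their phases at time [T] differ
    by [j r^2 eta T]. Since [j r^2] has the size of [j^{1-2s}], which is unbounded
    for [s < 1/2], one may choose [eta = PI / (T j r^2)], arbitrarily small, and
    make the two waves opposite at time [T]; their distance is then [1 + q].

    The solution map is a choice among smooth solutions, so this computation says
    something about it only if smooth solutions are unique
    ([smooth_global_solution_unique]). For two solutions with difference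
    [w = h + i k], the [L^2] energy of [w] satisfies [|E'| <= 28 K^2 E] on
    [-T, T], where [K] bounds both solutions and their first space derivatives
    ([energy_rate_bound]): the dispersive and transport terms are exact
    derivatives, and in the rest no derivative falls on [w]
    ([remainder_bound], [momentum_diff_le]). Gronwall's inequality then gives
    [w = 0]. *)

(** * Calculus on the line and over a period *)

Lemma is_derive_continuous (f : R -> R) (x l : R) :
  is_derive f x l -> continuous f x.
Proof. intros H. apply (ex_derive_continuous (V := R_NormedModule)). now exists l. Qed.

Lemma continuity_2d_slice (f : R -> R -> R) (t x : R) :
  continuity_2d_pt f t x -> continuous (f t) x.
Proof.
  intros H P [eps HP].
  destruct (H eps) as [d Hd].
  exists d; intros y Hy. apply HP, Hd.
  - rewrite Rminus_diag, Rabs_R0. apply cond_pos.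
  - exact Hy.
Qed.

Lemma ex_RInt_cont (f : R -> R) (a b : R) :
  (forall x, continuous f x) -> ex_RInt f a b.
Proof. intros H. apply (ex_RInt_continuous (V := R_CompleteNormedModule)). auto. Qed.

Lemma RInt_derivative_periodic (F f : R -> R) :
  (forall x, is_derive F x (f x)) -> (forall x, continuous f x) ->
  F (2 * PI) = F 0 -> RInt f 0 (2 * PI) = 0.
Proof.
  intros HF Hf HP.
  apply is_RInt_unique.
  replace 0 with (minus (F (2 * PI)) (F 0)) at 2.
  - now apply (is_RInt_derive (V := R_CompleteNormedModule)).
  - rewrite HP. exact (minus_eq_zero (G := R_AbelianGroup) _).
Qed.

Lemma RInt_nonneg_cont (f : R -> R) (a b : R) :
  a <= b -> (forall x, continuous f x) -> (forall x, 0 <= f x) ->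
  0 <= RInt f a b.
Proof. intros Hab Hc Hp. apply RInt_ge_0; auto. now apply ex_RInt_cont. Qed.

Lemma RInt_le_cont (f g : R -> R) (a b : R) :
  a <= b -> (forall x, continuous f x) -> (forall x, continuous g x) ->
  (forall x, a <= x <= b -> f x <= g x) -> RInt f a b <= RInt g a b.
Proof.
  intros Hab Hf Hg H. apply RInt_le; auto using ex_RInt_cont.
  intros x Hx. apply H. lra.
Qed.

Lemma RInt_lin_cont (f g : R -> R) (l m a b : R) :
  (forall x, continuous f x) -> (forall x, continuous g x) ->
  RInt (fun x => l * f x + m * g x) a b = l * RInt f a b + m * RInt g a b.
Proof.
  intros Hf Hg. apply is_RInt_unique.
  apply (is_RInt_plus (V := R_NormedModule));
    apply (is_RInt_scal (V := R_NormedModule));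
    apply (RInt_correct (V := R_CompleteNormedModule)); now apply ex_RInt_cont.
Qed.

Lemma RInt_const_R (c a b : R) : RInt (fun _ => c) a b = (b - a) * c.
Proof. now rewrite RInt_const. Qed.

Lemma continuous_pow (f : R -> R) (n : nat) (x : R) :
  continuous f x -> continuous (fun y => f y ^ n) x.
Proof.
  intros H. induction n as [|n IH]; [apply continuous_const|].
  now apply (continuous_mult (K := R_AbsRing) f (fun y => f y ^ n)).
Qed.

(** Splits a continuity goal along the arithmetic structure of the function; the
    leaves are left to the context. *)
Ltac cont :=
  lazymatch goal with
  | |- forall _, continuous _ _ => let x := fresh "x" in intro x; cont
  | |- continuous (fun y => @?f y + @?g y) _ =>
      apply (continuous_plus (V := R_NormedModule) f g); cont
  | |- continuous (fun y => @?f y - @?g y) _ =>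
      apply (continuous_minus (V := R_NormedModule) f g); cont
  | |- continuous (fun y => - @?f y) _ =>
      apply (continuous_opp (V := R_NormedModule) f); cont
  | |- continuous (fun y => @?f y * @?g y) _ =>
      apply (continuous_mult (K := R_AbsRing) f g); cont
  | |- continuous (fun y => @?f y ^ ?n) _ =>
      apply (continuous_pow f n); cont
  | |- continuous (fun y => Rabs (@?f y)) _ =>
      apply (continuous_comp f Rabs); [cont | apply continuous_Rabs]
  | |- continuous (fun _ => ?c) _ => apply continuous_const
  | |- _ => auto
  end.

Lemma two_pi_pos : 0 < 2 * PI.
Proof. pose proof PI_RGT_0; lra. Qed.

(** Expand [0 <= RInt (q - m)^2] with [m] the mean of [q]. *)
Lemma mean_cauchy_schwarz (q : R -> R) :
  (forall x, continuous q x) ->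
  2 * PI * mean q ^ 2 <= RInt (fun x => q x ^ 2) 0 (2 * PI).
Proof.
  intros Hq. pose proof two_pi_pos as HL. set (m := mean q).
  assert (Hm : 2 * PI * m = RInt q 0 (2 * PI)) by (unfold m, mean; field; lra).
  assert (H : 0 <= RInt (fun x => 1 * q x ^ 2 + 1 * (- (2 * m) * q x + m ^ 2 * 1)) 0 (2 * PI)).
  { apply RInt_nonneg_cont; [lra| |].
    - cont.
    - intro x. pose proof (pow2_ge_0 (q x - m)). nra. }
  rewrite RInt_lin_cont in H by cont.
  rewrite RInt_lin_cont in H by cont.
  rewrite <- Hm, RInt_const_R in H. nra.
Qed.

(** Uniform continuity turns into a bound: a point of the rectangle is reached
    from the corner [(-T, 0)] along a segment cut into a fixed number of steps so
    short that [f] varies by less than 1 along each. *)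
Lemma continuous_bounded_rectangle (f : R -> R -> R) (T L : R) :
  0 < T -> 0 < L -> (forall t x, continuity_2d_pt f t x) ->
  exists K, forall t x, - T <= t <= T -> 0 <= x <= L -> Rabs (f t x) <= K.
Proof.
  intros HT HL Hf.
  destruct (uniform_continuity_2d f (-T) T 0 L
              (fun x y _ _ => Hf x y) (mkposreal 1 Rlt_0_1)) as [d Hd].
  simpl in Hd.
  destruct (nfloor_ex ((2 * T + L) / d)) as [n [_ Hn]].
  { apply Rlt_le, Rdiv_lt_0_compat; [lra|apply cond_pos]. }
  set (m := INR n + 1) in *.
  assert (Hmp : 0 < m) by (pose proof (pos_INR n); unfold m; lra).
  assert (Hmd : 2 * T + L < m * d).
  { apply (Rmult_lt_compat_r d) in Hn; [|apply cond_pos].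
    replace ((2 * T + L) / d * d) with (2 * T + L) in Hn; [exact Hn|].
    field. apply Rgt_not_eq, cond_pos. }
  exists (Rabs (f (- T) 0) + m).
  intros t x Ht Hx.
  assert (Hstep : forall j, (j <= S n)%nat ->
    Rabs (f (- T + INR j / m * (t + T)) (INR j / m * x)) <= Rabs (f (- T) 0) + INR j).
  { induction j as [|j IH]; intros Hj.
    - simpl INR. replace (- T + 0 / m * (t + T)) with (- T) by (field; lra).
      replace (0 / m * x) with 0 by (field; lra). lra.
    - specialize (IH ltac:(lia)).
      assert (Hjm : INR j + 1 <= m).
      { apply le_INR in Hj. rewrite !S_INR in Hj. exact Hj. }
      rewrite S_INR. pose proof (pos_INR j) as Hj0.
      set (r := INR j / m) in *.
      assert (Hr : 0 <= r) by (apply Rdiv_le_0_compat; lra).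
      assert (Hr1 : (INR j + 1) / m = r + / m) by (unfold r; field; lra).
      assert (Hr2 : r + / m <= 1).
      { rewrite <- Hr1. apply (Rmult_le_reg_r m); [lra|].
        replace ((INR j + 1) / m * m) with (INR j + 1) by (field; lra). lra. }
      assert (Him : 0 < / m) by now apply Rinv_0_lt_compat.
      rewrite Hr1.
      assert (Hlt : forall y, 0 <= y <= 2 * T + L -> Rabs (/ m * y) < d).
      { intros y Hy. rewrite Rabs_pos_eq by nra.
        apply (Rmult_lt_reg_l m); [lra|].
        replace (m * (/ m * y)) with y by (field; lra). lra. }
      assert (D := Hd (- T + r * (t + T)) (r * x)
                      (- T + (r + / m) * (t + T)) ((r + / m) * x)).
      assert (D' : Rabs (f (- T + (r + / m) * (t + T)) ((r + / m) * x)
                         - f (- T + r * (t + T)) (r * x)) < 1).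
      { apply D; try nra.
        - replace (- T + (r + / m) * (t + T) - (- T + r * (t + T)))
            with (/ m * (t + T)) by ring. apply Hlt; lra.
        - replace ((r + / m) * x - r * x) with (/ m * x) by ring. apply Hlt; lra. }
      apply Rabs_le_between in IH. apply Rabs_lt_between in D'.
      apply Rabs_le_between. lra. }
  specialize (Hstep (S n) (le_n _)). rewrite S_INR in Hstep. fold m in Hstep.
  replace (- T + m / m * (t + T)) with t in Hstep by (field; lra).
  now replace (m / m * x) with x in Hstep by (field; lra).
Qed.

(** The function [E t * exp (- C t)] is nonincreasing. *)
Lemma gronwall_forward (E E' : R -> R) (C T : R) :
  0 <= T ->
  (forall t, is_derive E t (E' t)) ->
  (forall t, 0 <= t <= T -> E' t <= C * E t) ->
  E 0 = 0 -> E T <= 0.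
Proof.
  intros HT HE HC H0.
  assert (HD : forall t, is_derive (fun t => E t * exp (- C * t)) t
                           ((E' t - C * E t) * exp (- C * t))).
  { intros t. auto_derive; [now exists (E' t)|].
    change (Derive (fun x => E x)) with (Derive E).
    rewrite (is_derive_unique _ _ _ (HE t)). ring. }
  destruct (MVT_gen _ 0 T _ (fun t _ => HD t)) as [c [Hc Heq]].
  - intros t _. apply continuity_pt_filterlim.
    exact (is_derive_continuous _ _ _ (HD t)).
  - rewrite Rmin_left, Rmax_right in Hc by lra.
    specialize (HC c Hc).
    rewrite H0 in Heq.
    pose proof (exp_pos (- C * c)). pose proof (exp_pos (- C * T)).
    assert (HS : 0 <= (C * E c - E' c) * exp (- C * c)) by (apply Rmult_le_pos; lra).
    assert (E T * exp (- C * T) <= 0) by nra. nra.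
Qed.

Lemma gronwall_two_sided (E E' : R -> R) (C T : R) :
  (forall t, is_derive E t (E' t)) ->
  (forall t, - T <= t <= T -> Rabs (E' t) <= C * E t) ->
  E 0 = 0 -> forall t, - T <= t <= T -> E t <= 0.
Proof.
  intros HE HC H0 t Ht. destruct (Rle_dec 0 t) as [Hp|Hn].
  - apply (gronwall_forward E E' C); auto.
    intros r Hr. eapply Rle_trans; [apply Rle_abs|]. apply HC; lra.
  - replace t with (- - t) by ring.
    apply (gronwall_forward (fun r => E (- r)) (fun r => - E' (- r)) C); [lra| | |].
    + intros r. auto_derive; [now exists (E' (- r))|].
      change (Derive (fun x => E x)) with (Derive E).
      rewrite (is_derive_unique _ _ _ (HE (- r))). ring.
    + intros r Hr. eapply Rle_trans; [|apply HC; lra].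
      rewrite <- Rabs_Ropp. apply Rle_abs.
    + now rewrite Ropp_0.
Qed.

Lemma is_derive_zero_constant (f : R -> R) :
  (forall x, is_derive f x 0) -> forall x y, f x = f y.
Proof.
  intros H x y.
  destruct (MVT_gen f y x (fun _ => 0)) as [c [_ Hc]]; [auto| |lra].
  intros z _. apply continuity_pt_filterlim. exact (is_derive_continuous _ _ _ (H z)).
Qed.

(** The primitive of [g] is nondecreasing, and periodic because its increment over
    a period vanishes; hence it is constant. This reaches every [x] without
    reducing it to the fundamental period. *)
Lemma RInt_zero_nonneg_periodic (g : R -> R) :
  (forall x, continuous g x) -> (forall x, 0 <= g x) ->
  (forall x, g (x + 2 * PI) = g x) ->
  RInt g 0 (2 * PI) = 0 -> forall x, g x = 0.
Proof.
  intros Hc Hp Hper H0 x. pose proof two_pi_pos as HL. pose proof PI_RGT_0 as HPI.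
  set (F := fun y => RInt g 0 y).
  assert (HF : forall y, is_derive F y (g y)).
  { intro y. apply (is_derive_RInt (V := R_NormedModule) g F 0); auto.
    apply filter_forall. intro z.
    apply (RInt_correct (V := R_CompleteNormedModule)). now apply ex_RInt_cont. }
  assert (Hmono : forall y z, y <= z -> F y <= F z).
  { intros y z Hyz. unfold F.
    rewrite <- (RInt_Chasles g 0 y z) by now apply ex_RInt_cont.
    pose proof (RInt_nonneg_cont g y z Hyz Hc Hp). unfold plus; simpl. lra. }
  assert (HFper : forall y, F (y + 2 * PI) = F y).
  { intro y.
    assert (HD : forall z, is_derive (fun z => F (z + 2 * PI) - F z) z 0).
    { intro z. replace 0 with (minus (g (z + 2 * PI)) (g z)).
      - apply (is_derive_minus (V := R_NormedModule)); [|apply HF].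
        auto_derive; [now exists (g (z + 2 * PI))|].
        change (Derive (fun x => F x)) with (Derive F).
        rewrite (is_derive_unique _ _ _ (HF (z + 2 * PI))). ring.
      - rewrite Hper. exact (minus_eq_zero (G := R_AbelianGroup) _). }
    pose proof (is_derive_zero_constant _ HD y 0) as HE. simpl in HE.
    rewrite Rplus_0_l in HE. unfold F at 3 4 in HE.
    rewrite H0, RInt_point in HE. unfold zero in HE; simpl in HE. lra. }
  assert (Hloc : is_derive F x 0).
  { apply (is_derive_ext_loc (fun _ => F x)).
    - exists (mkposreal PI HPI). intros y Hy.
      apply Rabs_lt_between in Hy. unfold minus, plus, opp in Hy; simpl in Hy.
      apply Rle_antisym.
      + rewrite <- (HFper y). apply Hmono. lra.
      + rewrite <- (HFper x). apply Hmono. lra.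
    - apply (is_derive_const (V := R_NormedModule)). }
  rewrite <- (is_derive_unique _ _ _ (HF x)). now apply is_derive_unique.
Qed.

(** * Energy estimate in real components *)

(** Carrying the derivatives as data keeps the identities below polynomial in the
    components, so that [ring] proves them. *)
Record jet := {
  val :> R -> R -> R;
  dx1 : R -> R -> R;
  dx2 : R -> R -> R;
  dx3 : R -> R -> R;
  dt1 : R -> R -> R;
  is_derive_val : forall t x, is_derive (val t) x (dx1 t x);
  is_derive_dx1 : forall t x, is_derive (dx1 t) x (dx2 t x);
  is_derive_dx2 : forall t x, is_derive (dx2 t) x (dx3 t x);
  is_derive_time : forall t x, is_derive (fun t' => val t' x) t (dt1 t x);
  val_cont : forall t x, continuity_2d_pt val t x;
  dx1_cont : forall t x, continuity_2d_pt dx1 t x;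
  dx3_cont : forall t x, continuity_2d_pt dx3 t x;
  dt1_cont : forall t x, continuity_2d_pt dt1 t x;
  val_periodic : forall t x, val t (x + 2 * PI) = val t x;
  dx1_periodic : forall t x, dx1 t (x + 2 * PI) = dx1 t x;
  dx2_periodic : forall t x, dx2 t (x + 2 * PI) = dx2 t x
}.

Definition jet_minus (f g : jet) : jet.
Proof.
  refine {| val := fun t x => f t x - g t x;
            dx1 := fun t x => dx1 f t x - dx1 g t x;
            dx2 := fun t x => dx2 f t x - dx2 g t x;
            dx3 := fun t x => dx3 f t x - dx3 g t x;
            dt1 := fun t x => dt1 f t x - dt1 g t x |};
    intros t x; destruct f, g; simpl;
    first [ apply (is_derive_minus (V := R_NormedModule)); auto
          | apply continuity_2d_pt_minus; auto
          | f_equal; auto ].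
Defined.

Lemma jet_periodic_0 (f : jet) (t : R) :
  f t (2 * PI) = f t 0 /\ dx1 f t (2 * PI) = dx1 f t 0 /\ dx2 f t (2 * PI) = dx2 f t 0.
Proof.
  rewrite <- (Rplus_0_l (2 * PI)), val_periodic, dx1_periodic, dx2_periodic. auto.
Qed.

Lemma jet_cont_slices (f : jet) (t : R) :
  (forall x, continuous (f t) x) /\ (forall x, continuous (dx1 f t) x) /\
  (forall x, continuous (dx2 f t) x) /\ (forall x, continuous (dx3 f t) x) /\
  (forall x, continuous (dt1 f t) x).
Proof.
  repeat split; intro x.
  - apply continuity_2d_slice, val_cont.
  - apply continuity_2d_slice, dx1_cont.
  - exact (is_derive_continuous _ _ _ (is_derive_dx2 f t x)).
  - apply continuity_2d_slice, dx3_cont.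
  - apply continuity_2d_slice, dt1_cont.
Qed.

Definition mass_density (a b : jet) (t : R) : R := mean (fun x => a t x ^ 2 + b t x ^ 2).

Definition momentum (a b : jet) (t : R) : R :=
  mean (fun x => a t x * dx1 b t x - b t x * dx1 a t x).

(** The real and imaginary parts of the equation for [a + i b]. *)
Definition real_mKdV2 (sgn : R) (a b : jet) : Prop :=
  forall t x,
    dt1 a t x + dx3 a t x =
      sgn * ((a t x ^ 2 + b t x ^ 2) * dx1 a t x - mass_density a b t * dx1 a t x
             + momentum a b t * b t x) /\
    dt1 b t x + dx3 b t x =
      sgn * ((a t x ^ 2 + b t x ^ 2) * dx1 b t x - mass_density a b t * dx1 b t x
             - momentum a b t * a t x).

Definition energy (h k : jet) (t : R) : R :=
  RInt (fun x => h t x ^ 2 + k t x ^ 2) 0 (2 * PI).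

Lemma is_derive_sum_sq (p q : R -> R) (r p' q' : R) :
  is_derive p r p' -> is_derive q r q' ->
  is_derive (fun s => p s ^ 2 + q s ^ 2) r (2 * (p r * p' + q r * q')).
Proof.
  intros Hp Hq. auto_derive; [repeat split; eexists; eassumption|].
  change (Derive (fun x => p x)) with (Derive p).
  change (Derive (fun x => q x)) with (Derive q).
  rewrite (is_derive_unique _ _ _ Hp), (is_derive_unique _ _ _ Hq). ring.
Qed.

Lemma is_derive_energy (h k : jet) (t : R) :
  is_derive (energy h k) t
    (RInt (fun x => 2 * (h t x * dt1 h t x + k t x * dt1 k t x)) 0 (2 * PI)).
Proof.
  assert (HD : forall t x, is_derive (fun t => h t x ^ 2 + k t x ^ 2) t
                  (2 * (h t x * dt1 h t x + k t x * dt1 k t x))).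
  { intros r x.
    exact (is_derive_sum_sq _ _ _ _ _ (is_derive_time h r x) (is_derive_time k r x)). }
  rewrite <- (RInt_ext (fun x => Derive (fun t => h t x ^ 2 + k t x ^ 2) t)).
  2: { intros x _. apply is_derive_unique, HD. }
  apply is_derive_RInt_param.
  - apply filter_forall. intros r x _. eexists; apply HD.
  - intros x _.
    apply (continuity_2d_pt_ext
             (fun t x => 2 * (h t x * dt1 h t x + k t x * dt1 k t x))).
    + intros r y. symmetry. apply is_derive_unique, HD.
    + repeat first [ apply continuity_2d_pt_mult | apply continuity_2d_pt_plus
                   | apply continuity_2d_pt_const ];
        first [apply val_cont | apply dt1_cont].
  - apply filter_forall. intros r. apply ex_RInt_cont.
    destruct (jet_cont_slices h r) as [Ch _]. destruct (jet_cont_slices k r) as [Ck _].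
    cont.
Qed.

Lemma Rabs_mult_le (x y a b : R) : Rabs x <= a -> Rabs y <= b -> Rabs (x * y) <= a * b.
Proof.
  intros Hx Hy. rewrite Rabs_mult.
  apply Rmult_le_compat; auto using Rabs_pos.
Qed.

Lemma Rabs_plus_le (x y a b : R) : Rabs x <= a -> Rabs y <= b -> Rabs (x + y) <= a + b.
Proof. intros. eapply Rle_trans; [apply Rabs_triang|]. lra. Qed.

Lemma pairing_le (h k x y K : R) :
  Rabs x <= K -> Rabs y <= K -> Rabs (h * x + k * y) <= (Rabs h + Rabs k) * K.
Proof.
  intros Hx Hy. rewrite Rmult_plus_distr_r.
  apply Rabs_plus_le; apply Rabs_mult_le; auto using Rle_refl.
Qed.

Lemma sum_abs_sq_le (h k : R) : (Rabs h + Rabs k) ^ 2 <= 2 * (h ^ 2 + k ^ 2).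
Proof.
  rewrite <- (pow2_abs h), <- (pow2_abs k).
  pose proof (pow2_ge_0 (Rabs h - Rabs k)). nra.
Qed.

(** Once the total derivatives are removed, every term of the nonlinear
    difference is quadratic in the differences [h], [k] and in the mean [m] of
    [|h| + |k|], which bounds the differences [M] and [P] of the two nonlocal
    coefficients; no derivative falls on [h] or [k]. *)
Lemma remainder_bound (a b ax bx c d cx dx M P K m : R) :
  Rabs a <= K -> Rabs b <= K -> Rabs ax <= K -> Rabs bx <= K ->
  Rabs c <= K -> Rabs d <= K -> Rabs cx <= K -> Rabs dx <= K ->
  Rabs M <= 2 * K * m -> Rabs P <= 2 * K * m ->
  let h := a - c in let k := b - d in
  Rabs (- (a * ax + b * bx) * (h ^ 2 + k ^ 2)
        + (a ^ 2 + b ^ 2 - c ^ 2 - d ^ 2) * (h * cx + k * dx)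
        - M * (h * cx + k * dx) + P * (h * d - k * c))
  <= 10 * K ^ 2 * (h ^ 2 + k ^ 2) + 2 * K ^ 2 * m ^ 2.
Proof.
  intros Ha Hb Hax Hbx Hc Hd Hcx Hdx HM HP h k.
  assert (Hw : 0 <= h ^ 2 + k ^ 2) by (pose proof (pow2_ge_0 h); pose proof (pow2_ge_0 k); lra).
  pose proof (sum_abs_sq_le h k) as Hq.
  set (w := h ^ 2 + k ^ 2) in *. set (q := Rabs h + Rabs k) in *.
  assert (H1 : Rabs (- (a * ax + b * bx) * w) <= (K * K + K * K) * w).
  { apply Rabs_mult_le; [|rewrite Rabs_pos_eq; lra].
    rewrite Rabs_Ropp. apply Rabs_plus_le; now apply Rabs_mult_le. }
  assert (HF : Rabs (a ^ 2 + b ^ 2 - c ^ 2 - d ^ 2) <= q * (K + K)).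
  { replace (a ^ 2 + b ^ 2 - c ^ 2 - d ^ 2) with (h * (a + c) + k * (b + d))
      by (unfold h, k; ring).
    apply pairing_le; now apply Rabs_plus_le. }
  assert (HL : Rabs (h * cx + k * dx) <= q * K) by now apply pairing_le.
  assert (HR : Rabs (h * d - k * c) <= q * K).
  { replace (h * d - k * c) with (h * d + k * - c) by ring.
    apply pairing_le; now rewrite ?Rabs_Ropp. }
  pose proof (Rabs_mult_le _ _ _ _ HF HL) as H2.
  pose proof (Rabs_mult_le _ _ _ _ HM HL) as H3.
  pose proof (Rabs_mult_le _ _ _ _ HP HR) as H4.
  (* The four terms add up to 2K^2 w + 2K^2 q^2 + 4K^2 m q. *)
  assert (HS : 0 <= K ^ 2 * (q - m) ^ 2) by (apply Rmult_le_pos; apply pow2_ge_0).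
  assert (HT : 0 <= K ^ 2 * (2 * w - q ^ 2)) by (apply Rmult_le_pos; [apply pow2_ge_0|lra]).
  apply Rabs_le_between in H1, H2, H3, H4. apply Rabs_le_between. nra.
Qed.

Lemma mean_abs_le (f g : R -> R) (l : R) :
  (forall x, continuous f x) -> (forall x, continuous g x) ->
  (forall x, 0 <= x <= 2 * PI -> Rabs (f x) <= l * g x) ->
  Rabs (mean f) <= l * mean g.
Proof.
  intros Hf Hg H. pose proof two_pi_pos as HL.
  assert (HI : 0 < / (2 * PI)) by now apply Rinv_0_lt_compat.
  unfold mean. rewrite Rabs_mult, (Rabs_pos_eq (/ (2 * PI))) by lra.
  replace (l * (/ (2 * PI) * RInt g 0 (2 * PI)))
    with (/ (2 * PI) * (l * RInt g 0 (2 * PI) + 0 * RInt g 0 (2 * PI))) by ring.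
  apply Rmult_le_compat_l; [lra|].
  rewrite <- RInt_lin_cont by auto.
  eapply Rle_trans; [apply abs_RInt_le; [lra|now apply ex_RInt_cont]|].
  apply RInt_le_cont; [lra| | |].
  - cont.
  - cont.
  - intros x Hx. rewrite Rmult_0_l, Rplus_0_r. auto.
Qed.

(** Integration by parts over a period, in the form used for densities that agree
    up to an exact derivative. *)
Lemma mean_minus_derivative (f g r F F' : R -> R) :
  (forall x, continuous f x) -> (forall x, continuous g x) ->
  (forall x, continuous F' x) ->
  (forall x, is_derive F x (F' x)) -> F (2 * PI) = F 0 ->
  (forall x, f x - g x = r x + F' x) -> mean f - mean g = mean r.
Proof.
  intros Hf Hg HF' HF HP Heq. unfold mean.
  rewrite (RInt_ext r (fun x => 1 * (1 * f x + (- 1) * g x) + (- 1) * F' x)).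
  2: { intros x _. specialize (Heq x).
       match goal with |- ?l = ?r => change (@eq R l r) end. lra. }
  rewrite RInt_lin_cont by cont.
  rewrite RInt_lin_cont by cont.
  rewrite (RInt_derivative_periodic F F') by auto. ring.
Qed.

Definition mean_abs_diff (a b c d : jet) (t : R) : R :=
  mean (fun x => Rabs (a t x - c t x) + Rabs (b t x - d t x)).

Lemma mass_diff_le (a b c d : jet) (K t : R) :
  (forall x, 0 <= x <= 2 * PI ->
     Rabs (a t x) <= K /\ Rabs (b t x) <= K /\ Rabs (c t x) <= K /\ Rabs (d t x) <= K) ->
  Rabs (mass_density a b t - mass_density c d t) <= 2 * K * mean_abs_diff a b c d t.
Proof.
  intros HK.
  destruct (jet_cont_slices a t) as [Ca _]. destruct (jet_cont_slices b t) as [Cb _].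
  destruct (jet_cont_slices c t) as [Cc _]. destruct (jet_cont_slices d t) as [Cd _].
  unfold mass_density.
  rewrite (mean_minus_derivative _ _
             (fun x => a t x ^ 2 + b t x ^ 2 - (c t x ^ 2 + d t x ^ 2))
             (fun _ => 0) (fun _ => 0)).
  - apply mean_abs_le; try (cont; fail).
    intros x Hx. destruct (HK x Hx) as (Ka & Kb & Kc & Kd).
    replace (a t x ^ 2 + b t x ^ 2 - (c t x ^ 2 + d t x ^ 2))
      with ((a t x - c t x) * (a t x + c t x) + (b t x - d t x) * (b t x + d t x)) by ring.
    replace (2 * K * (Rabs (a t x - c t x) + Rabs (b t x - d t x)))
      with ((Rabs (a t x - c t x) + Rabs (b t x - d t x)) * (K + K)) by ring.
    apply pairing_le; now apply Rabs_plus_le.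
  - cont.
  - cont.
  - cont.
  - intros x. apply (is_derive_const (V := R_NormedModule)).
  - reflexivity.
  - intros x. ring.
Qed.

Lemma is_derive_det (p q r s : R -> R) (x p' q' r' s' : R) :
  is_derive p x p' -> is_derive q x q' -> is_derive r x r' -> is_derive s x s' ->
  is_derive (fun y => p y * q y - r y * s y) x
    (p' * q x + p x * q' - (r' * s x + r x * s')).
Proof.
  intros Hp Hq Hr Hs.
  auto_derive; [repeat split; eexists; eassumption|].
  change (Derive (fun x => p x)) with (Derive p).
  change (Derive (fun x => q x)) with (Derive q).
  change (Derive (fun x => r x)) with (Derive r).
  change (Derive (fun x => s x)) with (Derive s).
  rewrite (is_derive_unique _ _ _ Hp), (is_derive_unique _ _ _ Hq),
    (is_derive_unique _ _ _ Hr), (is_derive_unique _ _ _ Hs). ring.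
Qed.

(** The momentum contains a derivative, but integrating by parts moves it from the
    difference of the two solutions onto the solutions themselves, so that the
    [L^1] size of the difference is enough. *)
Lemma momentum_diff_le (a b c d : jet) (K t : R) :
  (forall x, 0 <= x <= 2 * PI ->
     Rabs (dx1 a t x) <= K /\ Rabs (dx1 b t x) <= K /\
     Rabs (dx1 c t x) <= K /\ Rabs (dx1 d t x) <= K) ->
  Rabs (momentum a b t - momentum c d t) <= 2 * K * mean_abs_diff a b c d t.
Proof.
  intros HK.
  destruct (jet_cont_slices a t) as (Ca & Cax & _).
  destruct (jet_cont_slices b t) as (Cb & Cbx & _).
  destruct (jet_cont_slices c t) as (Cc & Ccx & _).
  destruct (jet_cont_slices d t) as (Cd & Cdx & _).
  destruct (jet_periodic_0 a t) as [Pa _]. destruct (jet_periodic_0 b t) as [Pb _].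
  destruct (jet_periodic_0 c t) as [Pc _]. destruct (jet_periodic_0 d t) as [Pd _].
  unfold momentum.
  rewrite (mean_minus_derivative _ _
             (fun x => (a t x - c t x) * (dx1 b t x + dx1 d t x)
                       + (b t x - d t x) * - (dx1 a t x + dx1 c t x))
             (fun x => c t x * (b t x - d t x) - d t x * (a t x - c t x))
             (fun x => dx1 c t x * (b t x - d t x) + c t x * (dx1 b t x - dx1 d t x)
                       - (dx1 d t x * (a t x - c t x) + d t x * (dx1 a t x - dx1 c t x)))).
  - apply mean_abs_le; try (cont; fail).
    intros x Hx. destruct (HK x Hx) as (Ka & Kb & Kc & Kd).
    replace (2 * K * (Rabs (a t x - c t x) + Rabs (b t x - d t x)))
      with ((Rabs (a t x - c t x) + Rabs (b t x - d t x)) * (K + K)) by ring.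
    apply pairing_le; rewrite ?Rabs_Ropp; now apply Rabs_plus_le.
  - cont.
  - cont.
  - cont.
  - intros x.
    apply (is_derive_det (c t) (jet_minus b d t) (d t) (jet_minus a c t)); apply is_derive_val.
  - now rewrite Pa, Pb, Pc, Pd.
  - intros x. ring.
Qed.

(** The flux collects the terms of the energy identity that are exact
    derivatives: the dispersive part [h h_xxx + k k_xxx], and the transport part
    with velocity [A^2 + B^2 - m]. *)
Lemma is_derive_flux (A B : R -> R) (m sgn x A' B' : R)
    (h hx hxx hxxx k kx kxx kxxx : R -> R) :
  is_derive h x (hx x) -> is_derive hx x (hxx x) -> is_derive hxx x (hxxx x) ->
  is_derive k x (kx x) -> is_derive kx x (kxx x) -> is_derive kxx x (kxxx x) ->
  is_derive A x A' -> is_derive B x B' ->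
  is_derive (fun y => - (h y * hxx y - hx y ^ 2 / 2 + k y * kxx y - kx y ^ 2 / 2)
                      + sgn * ((A y ^ 2 + B y ^ 2 - m) * (h y ^ 2 + k y ^ 2) / 2)) x
    (- (h x * hxxx x + k x * kxxx x)
     + sgn * ((A x * A' + B x * B') * (h x ^ 2 + k x ^ 2)
              + (A x ^ 2 + B x ^ 2 - m) * (h x * hx x + k x * kx x))).
Proof.
  intros H0 H1 H2 K0 K1 K2 HA HB.
  auto_derive; [repeat split; eexists; eassumption|].
  change (Derive (fun x => h x)) with (Derive h).
  change (Derive (fun x => hx x)) with (Derive hx).
  change (Derive (fun x => hxx x)) with (Derive hxx).
  change (Derive (fun x => k x)) with (Derive k).
  change (Derive (fun x => kx x)) with (Derive kx).
  change (Derive (fun x => kxx x)) with (Derive kxx).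
  change (Derive (fun x => A x)) with (Derive A).
  change (Derive (fun x => B x)) with (Derive B).
  rewrite (is_derive_unique _ _ _ H0), (is_derive_unique _ _ _ H1),
    (is_derive_unique _ _ _ H2), (is_derive_unique _ _ _ K0), (is_derive_unique _ _ _ K1),
    (is_derive_unique _ _ _ K2), (is_derive_unique _ _ _ HA), (is_derive_unique _ _ _ HB).
  field.
Qed.

(** With [h = a - c] and [k = b - d], the equations give
    [h h_t + k k_t = flux' + sgn * rem]: the flux integrates to zero over a
    period, and [rem] is the expression of [remainder_bound]. *)
Lemma energy_rate_bound (sgn : R) (a b c d : jet) (K t : R) :
  sgn = 1 \/ sgn = -1 ->
  real_mKdV2 sgn a b -> real_mKdV2 sgn c d ->
  (forall x, 0 <= x <= 2 * PI ->
     (Rabs (a t x) <= K /\ Rabs (b t x) <= K /\ Rabs (c t x) <= K /\ Rabs (d t x) <= K) /\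
     (Rabs (dx1 a t x) <= K /\ Rabs (dx1 b t x) <= K /\
      Rabs (dx1 c t x) <= K /\ Rabs (dx1 d t x) <= K)) ->
  Rabs (RInt (fun x => 2 * ((a t x - c t x) * (dt1 a t x - dt1 c t x)
                            + (b t x - d t x) * (dt1 b t x - dt1 d t x))) 0 (2 * PI))
  <= 28 * K ^ 2 * energy (jet_minus a c) (jet_minus b d) t.
Proof.
  intros Hsgn Eu Ev HK. pose proof two_pi_pos as HL.
  pose proof (mass_diff_le a b c d K t (fun x Hx => proj1 (HK x Hx))) as HM.
  pose proof (momentum_diff_le a b c d K t (fun x Hx => proj2 (HK x Hx))) as HP.
  destruct (jet_cont_slices a t) as (Ca & Cax & Caxx & Caxxx & Cat).
  destruct (jet_cont_slices b t) as (Cb & Cbx & Cbxx & Cbxxx & Cbt).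
  destruct (jet_cont_slices c t) as (Cc & Ccx & Ccxx & Ccxxx & Cct).
  destruct (jet_cont_slices d t) as (Cd & Cdx & Cdxx & Cdxxx & Cdt).
  destruct (jet_periodic_0 a t) as (Pa & Pax & Paxx).
  destruct (jet_periodic_0 b t) as (Pb & Pbx & Pbxx).
  destruct (jet_periodic_0 c t) as (Pc & Pcx & Pcxx).
  destruct (jet_periodic_0 d t) as (Pd & Pdx & Pdxx).
  set (m := mean_abs_diff a b c d t) in *.
  set (M := mass_density a b t) in *. set (M' := mass_density c d t) in *.
  set (P := momentum a b t) in *. set (P' := momentum c d t) in *.
  set (w := fun x => (a t x - c t x) ^ 2 + (b t x - d t x) ^ 2).
  change (energy (jet_minus a c) (jet_minus b d) t) with (RInt w 0 (2 * PI)).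
  set (flux' := fun x =>
     - ((a t x - c t x) * (dx3 a t x - dx3 c t x) + (b t x - d t x) * (dx3 b t x - dx3 d t x))
     + sgn * ((a t x * dx1 a t x + b t x * dx1 b t x) * ((a t x - c t x) ^ 2 + (b t x - d t x) ^ 2)
              + (a t x ^ 2 + b t x ^ 2 - M)
                * ((a t x - c t x) * (dx1 a t x - dx1 c t x)
                   + (b t x - d t x) * (dx1 b t x - dx1 d t x)))).
  set (rem := fun x =>
     - (a t x * dx1 a t x + b t x * dx1 b t x) * ((a t x - c t x) ^ 2 + (b t x - d t x) ^ 2)
     + (a t x ^ 2 + b t x ^ 2 - c t x ^ 2 - d t x ^ 2)
       * ((a t x - c t x) * dx1 c t x + (b t x - d t x) * dx1 d t x)
     - (M - M') * ((a t x - c t x) * dx1 c t x + (b t x - d t x) * dx1 d t x)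
     + (P - P') * ((a t x - c t x) * d t x - (b t x - d t x) * c t x)).
  assert (Cw : forall x, continuous w x) by (unfold w; cont).
  assert (Cr : forall x, continuous rem x) by (unfold rem; cont).
  assert (Cf : forall x, continuous flux' x) by (unfold flux'; cont).
  rewrite (RInt_ext _ (fun x => 2 * flux' x + (2 * sgn) * rem x)).
  2: { intros x _. unfold flux', rem.
       destruct (Eu t x) as [Ea Eb]. destruct (Ev t x) as [Ec Ed].
       fold M in Ea, Eb. fold M' in Ec, Ed. fold P in Ea, Eb. fold P' in Ec, Ed.
       replace (dt1 a t x) with (dt1 a t x + dx3 a t x - dx3 a t x) by ring.
       replace (dt1 b t x) with (dt1 b t x + dx3 b t x - dx3 b t x) by ring.
       replace (dt1 c t x) with (dt1 c t x + dx3 c t x - dx3 c t x) by ring.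
       replace (dt1 d t x) with (dt1 d t x + dx3 d t x - dx3 d t x) by ring.
       rewrite Ea, Eb, Ec, Ed.
       match goal with |- ?l = ?r => change (@eq R l r) end. ring. }
  rewrite RInt_lin_cont by cont.
  assert (Hflux : RInt flux' 0 (2 * PI) = 0).
  { apply (RInt_derivative_periodic (fun x =>
      - ((a t x - c t x) * (dx2 a t x - dx2 c t x) - (dx1 a t x - dx1 c t x) ^ 2 / 2
         + (b t x - d t x) * (dx2 b t x - dx2 d t x) - (dx1 b t x - dx1 d t x) ^ 2 / 2)
      + sgn * ((a t x ^ 2 + b t x ^ 2 - M)
               * ((a t x - c t x) ^ 2 + (b t x - d t x) ^ 2) / 2))); auto.
    - intros x.
      pose (h := jet_minus a c). pose (k := jet_minus b d).
      apply (is_derive_flux (a t) (b t) M sgn x (dx1 a t x) (dx1 b t x)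
               (h t) (dx1 h t) (dx2 h t) (dx3 h t) (k t) (dx1 k t) (dx2 k t) (dx3 k t));
        first [apply is_derive_val | apply is_derive_dx1 | apply is_derive_dx2].
    - now rewrite Pa, Pax, Paxx, Pb, Pbx, Pbxx, Pc, Pcx, Pcxx, Pd, Pdx, Pdxx. }
  rewrite Hflux, Rmult_0_r, Rplus_0_l, Rmult_assoc.
  assert (HR : Rabs (RInt rem 0 (2 * PI)) <= 14 * K ^ 2 * RInt w 0 (2 * PI)).
  { eapply Rle_trans; [apply abs_RInt_le; [lra|now apply ex_RInt_cont]|].
    eapply Rle_trans.
    - apply (RInt_le_cont _ (fun x => 10 * K ^ 2 * w x + 2 * K ^ 2 * (m ^ 2))); [lra| | |].
      + cont.
      + cont.
      + intros x Hx. destruct (HK x Hx) as ((Ka & Kb & Kc & Kd) & Kax & Kbx & Kcx & Kdx).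
        apply remainder_bound; auto.
    - rewrite (RInt_lin_cont w (fun _ => m ^ 2)) by cont.
      rewrite RInt_const_R.
      assert (HCS : 2 * PI * m ^ 2 <= 2 * RInt w 0 (2 * PI)).
      { eapply Rle_trans; [apply mean_cauchy_schwarz; cont|].
        replace (2 * RInt w 0 (2 * PI))
          with (2 * RInt w 0 (2 * PI) + 0 * RInt w 0 (2 * PI)) by ring.
        rewrite <- RInt_lin_cont by auto.
        apply RInt_le_cont; [lra| | |]; try (cont; fail).
        intros x _. rewrite Rmult_0_l, Rplus_0_r. apply sum_abs_sq_le. }
      pose proof (pow2_ge_0 K). nra. }
  assert (Hs : Rabs sgn = 1).
  { destruct Hsgn as [-> | ->]; [apply Rabs_R1|].
    change (-1) with (- (1)). rewrite Rabs_Ropp. apply Rabs_R1. }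
  rewrite !Rabs_mult, Hs, Rabs_pos_eq by lra. lra.
Qed.

Lemma jet_bounded (f : jet) (T : R) :
  0 < T -> exists K, forall t x, - T <= t <= T -> 0 <= x <= 2 * PI ->
    Rabs (f t x) <= K /\ Rabs (dx1 f t x) <= K.
Proof.
  intros HT.
  destruct (continuous_bounded_rectangle f T (2 * PI) HT two_pi_pos (val_cont f)) as [K0 H0].
  destruct (continuous_bounded_rectangle (dx1 f) T (2 * PI) HT two_pi_pos (dx1_cont f)) as [K1 H1].
  exists (Rmax K0 K1). intros t x Ht Hx. split.
  - eapply Rle_trans; [now apply H0|apply Rmax_l].
  - eapply Rle_trans; [now apply H1|apply Rmax_r].
Qed.

(** The energy of the difference vanishes at time [0], so Gronwall's inequality on
    a time interval around [t] makes it vanish at [t]. *)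
Lemma real_uniqueness (sgn : R) (a b c d : jet) :
  sgn = 1 \/ sgn = -1 ->
  real_mKdV2 sgn a b -> real_mKdV2 sgn c d ->
  (forall x, a 0 x = c 0 x /\ b 0 x = d 0 x) ->
  forall t x, a t x = c t x /\ b t x = d t x.
Proof.
  intros Hsgn Eu Ev H0 t. pose proof two_pi_pos as HL.
  set (T := Rabs t + 1).
  assert (HT : 0 < T) by (unfold T; pose proof (Rabs_pos t); lra).
  destruct (jet_bounded a T HT) as [Ka HKa]. destruct (jet_bounded b T HT) as [Kb HKb].
  destruct (jet_bounded c T HT) as [Kc HKc]. destruct (jet_bounded d T HT) as [Kd HKd].
  set (K := Rmax (Rmax Ka Kb) (Rmax Kc Kd)).
  assert (KaK : Ka <= K) by (unfold K; eapply Rle_trans; [apply Rmax_l|apply Rmax_l]).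
  assert (KbK : Kb <= K) by (unfold K; eapply Rle_trans; [apply Rmax_r|apply Rmax_l]).
  assert (KcK : Kc <= K) by (unfold K; eapply Rle_trans; [apply Rmax_l|apply Rmax_r]).
  assert (KdK : Kd <= K) by (unfold K; eapply Rle_trans; [apply Rmax_r|apply Rmax_r]).
  assert (HE : energy (jet_minus a c) (jet_minus b d) t <= 0).
  { apply (gronwall_two_sided _ _ (28 * K ^ 2) T
             (is_derive_energy (jet_minus a c) (jet_minus b d))).
    - intros r Hr.
      apply (energy_rate_bound sgn a b c d K r); auto.
      intros x Hx.
      destruct (HKa r x Hr Hx), (HKb r x Hr Hx), (HKc r x Hr Hx), (HKd r x Hr Hx).
      repeat split; lra.
    - unfold energy; simpl. rewrite (RInt_ext _ (fun _ => 0)).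
      + rewrite RInt_const_R. ring.
      + intros x _. destruct (H0 x) as [-> ->].
        match goal with |- ?l = ?r => change (@eq R l r) end. ring.
    - apply Rabs_le_between. unfold T. lra. }
  destruct (jet_cont_slices a t) as [Ca _]. destruct (jet_cont_slices b t) as [Cb _].
  destruct (jet_cont_slices c t) as [Cc _]. destruct (jet_cont_slices d t) as [Cd _].
  assert (Hpos : forall y, 0 <= (a t y - c t y) ^ 2 + (b t y - d t y) ^ 2).
  { intros y. pose proof (pow2_ge_0 (a t y - c t y)).
    pose proof (pow2_ge_0 (b t y - d t y)). lra. }
  intros x.
  assert (Hx : (a t x - c t x) ^ 2 + (b t x - d t x) ^ 2 = 0).
  { apply (RInt_zero_nonneg_periodic
      (fun x => (a t x - c t x) ^ 2 + (b t x - d t x) ^ 2)).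
    - cont.
    - exact Hpos.
    - intros y. now rewrite !val_periodic.
    - apply Rle_antisym; [exact HE|]. apply RInt_nonneg_cont; [lra|cont|exact Hpos]. }
  pose proof (pow2_ge_0 (a t x - c t x)). pose proof (pow2_ge_0 (b t x - d t x)).
  split; apply Rminus_diag_uniq, Rsqr_0_uniq; rewrite Rsqr_pow2; lra.
Qed.

(** * Uniqueness of smooth solutions *)

Lemma is_derive_Re_Im (g : R -> C) (x : R) (l : C) :
  is_derive (V := C_R_NormedModule) g x l ->
  is_derive (fun y => Re (g y)) x (Re l) /\ is_derive (fun y => Im (g y)) x (Im l).
Proof.
  intros Hl. split; eapply filterdiff_ext_lin.
  - apply (filterdiff_comp' (V := C_R_NormedModule) (W := R_NormedModule)
             g fst x (fun y => scal y l) fst Hl).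
    apply filterdiff_linear, (is_linear_fst (U := R_NormedModule) (V := R_NormedModule)).
  - reflexivity.
  - apply (filterdiff_comp' (V := C_R_NormedModule) (W := R_NormedModule)
             g snd x (fun y => scal y l) snd Hl).
    apply filterdiff_linear, (is_linear_snd (U := R_NormedModule) (V := R_NormedModule)).
  - reflexivity.
Qed.

Lemma is_derive_components (g : R -> C) (x : R) :
  ex_derive (V := C_R_NormedModule) g x ->
  is_derive (fun y => Re (g y)) x (Re (deriv g x)) /\
  is_derive (fun y => Im (g y)) x (Im (deriv g x)).
Proof.
  intros [l Hl]. destruct (is_derive_Re_Im g x l Hl).
  split; apply Derive_correct; eexists; eassumption.
Qed.

Lemma continuity_2d_components (v : R -> R -> C) (t x : R) :
  continuous (T := prod_UniformSpace R_UniformSpace R_UniformSpace)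
      (U := C_R_NormedModule) (fun z => v (fst z) (snd z)) (t, x) ->
  continuity_2d_pt (fun t x => Re (v t x)) t x /\
  continuity_2d_pt (fun t x => Im (v t x)) t x.
Proof.
  intros H. split; apply continuity_2d_pt_filterlim.
  - apply (filterlim_comp _ _ _ _ fst _ _ _ H).
    change (v (fst (t, x)) (snd (t, x))) with (v t x).
    destruct (v t x) as [p q].
    apply (continuous_fst (U := R_UniformSpace) (V := R_UniformSpace) p q).
  - apply (filterlim_comp _ _ _ _ snd _ _ _ H).
    change (v (fst (t, x)) (snd (t, x))) with (v t x).
    destruct (v t x) as [p q].
    apply (continuous_snd (U := R_UniformSpace) (V := R_UniformSpace) p q).
Qed.

Lemma Derive_periodic (f : R -> R) (L : R) :
  (forall x, f (x + L) = f x) -> forall x, Derive f (x + L) = Derive f x.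
Proof.
  intros H x. unfold Derive. f_equal. apply Lim_ext. intros h.
  rewrite <- (H (x + h)), <- (H x). now replace (x + L + h) with (x + h + L) by ring.
Qed.

Lemma deriv_periodic (f : R -> C) : periodic f -> periodic (deriv f).
Proof.
  intros H x. unfold deriv. f_equal; apply Derive_periodic; intros y; now rewrite H.
Qed.

Lemma smooth_dx_periodic (u : R -> R -> C) :
  smooth_on_RxT u ->
  (forall t, periodic (dx u t)) /\ (forall t, periodic (dx (dx u) t)).
Proof.
  intros [Hp _].
  assert (Hp1 : forall t, periodic (dx u t)) by (intro t; apply deriv_periodic, Hp).
  split; [exact Hp1|]. intro t. apply deriv_periodic, Hp1.
Qed.

(** Each field of the jet of a component comes from the regularity hypothesis for
    one word of derivatives of length at most three. *)
Ltac solve_component_jet Hu :=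
  destruct (smooth_dx_periodic _ Hu) as [Hp1 Hp2]; destruct Hu as [Hp Hs];
  assert (S0 := Hs nil); assert (S1 := Hs (false :: nil));
  assert (S2 := Hs (false :: false :: nil));
  assert (S3 := Hs (false :: false :: false :: nil));
  assert (ST := Hs (true :: nil)); simpl in S0, S1, S2, S3, ST;
  intros t x;
  first
    [ now rewrite (Hp t x) | now rewrite (Hp1 t x) | now rewrite (Hp2 t x)
    | apply (is_derive_components (fun t' => _ t' x) t (proj1 (S0 t x)))
    | apply (is_derive_components _ x (proj1 (proj2 (S0 t x))))
    | apply (is_derive_components _ x (proj1 (proj2 (S1 t x))))
    | apply (is_derive_components _ x (proj1 (proj2 (S2 t x))))
    | apply (continuity_2d_components _ t x (proj2 (proj2 (S0 t x))))
    | apply (continuity_2d_components _ t x (proj2 (proj2 (S1 t x))))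
    | apply (continuity_2d_components _ t x (proj2 (proj2 (S3 t x))))
    | apply (continuity_2d_components _ t x (proj2 (proj2 (ST t x)))) ].

Definition Re_jet (u : R -> R -> C) (Hu : smooth_on_RxT u) : jet.
Proof.
  refine {| val := fun t x => Re (u t x); dx1 := fun t x => Re (dx u t x);
            dx2 := fun t x => Re (dx (dx u) t x); dx3 := fun t x => Re (dx (dx (dx u)) t x);
            dt1 := fun t x => Re (dt u t x) |}; solve_component_jet Hu.
Defined.

Definition Im_jet (u : R -> R -> C) (Hu : smooth_on_RxT u) : jet.
Proof.
  refine {| val := fun t x => Im (u t x); dx1 := fun t x => Im (dx u t x);
            dx2 := fun t x => Im (dx (dx u) t x); dx3 := fun t x => Im (dx (dx (dx u)) t x);
            dt1 := fun t x => Im (dt u t x) |}; solve_component_jet Hu.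
Defined.

Lemma Cmod_sq (z : C) : Cmod z ^ 2 = Re z ^ 2 + Im z ^ 2.
Proof.
  unfold Cmod, Re, Im. rewrite <- Rsqr_pow2, Rsqr_sqrt; [reflexivity|].
  pose proof (pow2_ge_0 (fst z)). pose proof (pow2_ge_0 (snd z)). lra.
Qed.

Lemma mean_ext (f g : R -> R) : (forall x, f x = g x) -> mean f = mean g.
Proof. intros H. unfold mean. f_equal. apply RInt_ext. auto. Qed.

Lemma mKdV2_components (sgn : R) (u : R -> R -> C) (Hu : smooth_on_RxT u) :
  mKdV2 sgn u -> real_mKdV2 sgn (Re_jet u Hu) (Im_jet u Hu).
Proof.
  intros H t x; specialize (H t x).
  assert (HM : mean (fun y => Cmod (u t y) ^ 2)
               = mass_density (Re_jet u Hu) (Im_jet u Hu) t).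
  { apply mean_ext. intro y. apply Cmod_sq. }
  assert (HP : mean (fun y => Im (Cconj (u t y) * dx u t y)%C)
               = momentum (Re_jet u Hu) (Im_jet u Hu) t).
  { apply mean_ext. intro y. unfold Re_jet, Im_jet, Re, Im, Cconj, Cmult; simpl. ring. }
  rewrite HM, HP, Cmod_sq in H.
  set (M := mass_density (Re_jet u Hu) (Im_jet u Hu) t) in *.
  set (P := momentum (Re_jet u Hu) (Im_jet u Hu) t) in *.
  clearbody M P. clear HM HP.
  split; [apply (f_equal Re) in H|apply (f_equal Im) in H];
    unfold Cplus, Cmult, Cminus, Copp, RtoC, Ci, Re, Im in *; simpl in *;
    (etransitivity; [exact H|]); unfold Re, Im; ring.
Qed.

Lemma smooth_global_solution_unique (sgn : R) (u0 : R -> C) (u v : R -> R -> C) :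
  sgn = 1 \/ sgn = -1 ->
  smooth_global_solution sgn u0 u -> smooth_global_solution sgn u0 v -> u = v.
Proof.
  intros Hsgn (Su & Eu & Iu) (Sv & Ev & Iv).
  apply (mKdV2_components sgn u Su) in Eu. apply (mKdV2_components sgn v Sv) in Ev.
  extensionality t. extensionality x.
  destruct (real_uniqueness sgn _ _ _ _ Hsgn Eu Ev) with (t := t) (x := x) as [HRe HIm].
  - intros y. simpl. now rewrite Iu, Iv.
  - now apply injective_projections.
Qed.

(** * Plane waves *)

(** The pair is written as a combination of the constant vectors [(1, 0)] and
    [(0, 1)], to which the rules for sums and scalar multiples apply. *)
Lemma is_derive_pair (f g : R -> R) (x f' g' : R) :
  is_derive f x f' -> is_derive g x g' ->
  is_derive (V := C_R_NormedModule) (fun y => (f y, g y)) x (f', g').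
Proof.
  intros Hf Hg.
  apply (is_derive_ext (V := C_R_NormedModule)
    (fun y => plus (scal (f y) ((1, 0) : C_R_NormedModule))
                   (scal (g y) ((0, 1) : C_R_NormedModule)))).
  { intros y. apply injective_projections; simpl; unfold scal, plus; simpl;
      unfold mult; simpl; ring. }
  replace (f', g') with
    (plus (scal f' ((1, 0) : C_R_NormedModule)) (scal g' ((0, 1) : C_R_NormedModule))).
  - apply (is_derive_plus (V := C_R_NormedModule)); now apply (is_derive_scal_l (K := R_AbsRing)).
  - apply injective_projections; simpl; unfold scal, plus; simpl; unfold mult; simpl; ring.
Qed.

Lemma expi_plus (x y : R) : expi (x + y) = (expi x * expi y)%C.
Proof.
  unfold expi, Cmult; simpl. rewrite cos_plus, sin_plus. f_equal; ring.
Qed.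

Lemma Cmod_expi (x : R) : Cmod (expi x) = 1.
Proof.
  unfold Cmod, expi; simpl. etransitivity; [|apply sqrt_1]. f_equal.
  pose proof (sin2_cos2 x) as H. unfold Rsqr in H. lra.
Qed.

Lemma expi_2PI_nat (n : nat) : expi (2 * INR n * PI) = 1.
Proof.
  unfold expi. rewrite <- (Rplus_0_l (2 * INR n * PI)), cos_period, sin_period, cos_0, sin_0.
  reflexivity.
Qed.

Lemma expi_2PI_int (n : Z) : expi (IZR n * (2 * PI)) = 1.
Proof.
  destruct (Z_le_gt_dec 0 n) as [H|H].
  - rewrite <- (expi_2PI_nat (Z.to_nat n)), INR_IZR_INZ, Z2Nat.id by exact H. f_equal. ring.
  - assert (E := expi_2PI_nat (Z.to_nat (- n))).
    rewrite INR_IZR_INZ, Z2Nat.id, opp_IZR in E by lia.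
    rewrite <- (Cmult_1_r (expi _)), <- E at 1.
    rewrite <- expi_plus.
    replace (IZR n * (2 * PI) + 2 * - IZR n * PI) with 0 by ring.
    unfold expi. now rewrite cos_0, sin_0.
Qed.

Lemma is_derive_exponential (z : C) (k c y : R) :
  is_derive (V := C_R_NormedModule) (fun y => z * expi (k * y + c))%C y
    (Ci * RtoC k * z * expi (k * y + c))%C.
Proof.
  destruct z as [p q].
  apply (is_derive_ext (V := C_R_NormedModule)
    (fun y => (p * cos (k * y + c) - q * sin (k * y + c),
               p * sin (k * y + c) + q * cos (k * y + c)))); [reflexivity|].
  replace (Ci * RtoC k * (p, q) * expi (k * y + c))%C
    with (- k * (p * sin (k * y + c) + q * cos (k * y + c)),
          k * (p * cos (k * y + c) - q * sin (k * y + c))).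
  - apply is_derive_pair; auto_derive; trivial; ring.
  - apply injective_projections; simpl; ring.
Qed.

Lemma deriv_unique (g : R -> C) (x : R) (l : C) :
  is_derive (V := C_R_NormedModule) g x l -> deriv g x = l.
Proof.
  intros H. destruct (is_derive_Re_Im g x l H) as [H1 H2].
  apply injective_projections; now apply is_derive_unique.
Qed.

Definition wave (k om : R) (z : C) (t x : R) : C := (z * expi (k * x + om * t))%C.

Definition mode (k : R) (z : C) (x : R) : C := (z * expi (k * x))%C.

Lemma wave_slice k om z t : wave k om z t = mode k (z * expi (om * t))%C.
Proof.
  extensionality x. unfold wave, mode. rewrite expi_plus. ring.
Qed.

Lemma is_derive_mode k z x :
  is_derive (V := C_R_NormedModule) (mode k z) x (mode k (Ci * RtoC k * z)%C x).
Proof.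
  pose proof (is_derive_exponential z k 0 x) as H. rewrite Rplus_0_r in H.
  apply (is_derive_ext (V := C_R_NormedModule) (fun y => z * expi (k * y + 0))%C); [|exact H].
  intros y. now rewrite Rplus_0_r.
Qed.

Lemma is_derive_wave_x k om z t x :
  is_derive (V := C_R_NormedModule) (wave k om z t) x (wave k om (Ci * RtoC k * z)%C t x).
Proof. apply is_derive_exponential. Qed.

Lemma is_derive_wave_t k om z t x :
  is_derive (V := C_R_NormedModule) (fun t => wave k om z t x) t
    (wave k om (Ci * RtoC om * z)%C t x).
Proof.
  unfold wave. rewrite (Rplus_comm (k * x)).
  apply (is_derive_ext (V := C_R_NormedModule) (fun t => z * expi (om * t + k * x))%C).
  - intros r. now rewrite (Rplus_comm (k * x)).
  - apply is_derive_exponential.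
Qed.

Lemma dx_wave k om z : dx (wave k om z) = wave k om (Ci * RtoC k * z)%C.
Proof.
  extensionality t. extensionality x. apply deriv_unique, is_derive_wave_x.
Qed.

Lemma dt_wave k om z : dt (wave k om z) = wave k om (Ci * RtoC om * z)%C.
Proof.
  extensionality t. extensionality x.
  apply (deriv_unique (fun t => wave k om z t x)), is_derive_wave_t.
Qed.

(** Either derivative only changes the amplitude, so one statement about waves
    covers the partial derivatives of every order. *)
Lemma partial_wave w k om z : exists z', partial w (wave k om z) = wave k om z'.
Proof.
  induction w as [|b w [z' IH]]; [now exists z|].
  simpl. rewrite IH. destruct b; eexists; [apply dt_wave|apply dx_wave].
Qed.

Lemma wave_continuous k om z t x :
  continuous (T := prod_UniformSpace R_UniformSpace R_UniformSpace)
    (U := C_R_NormedModule) (fun p => wave k om z (fst p) (snd p)) (t, x).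
Proof.
  apply (continuous_comp (U := prod_UniformSpace R_UniformSpace R_UniformSpace)
           (V := R_UniformSpace) (W := C_R_NormedModule)
           (fun p => k * snd p + om * fst p) (fun y => z * expi y)%C).
  - apply (continuous_plus (V := R_NormedModule) (fun p : R * R => k * snd p) (fun p => om * fst p)).
    + apply (continuous_scal_r (V := R_NormedModule) k snd), continuous_snd.
    + apply (continuous_scal_r (V := R_NormedModule) om fst), continuous_fst.
  - apply (ex_derive_continuous (V := C_R_NormedModule)).
    eexists. apply (is_derive_ext (V := C_R_NormedModule) (fun y => z * expi (1 * y + 0))%C).
    + intros y. now rewrite Rmult_1_l, Rplus_0_r.
    + apply is_derive_exponential.
Qed.

Lemma mode_periodic (n : Z) z : periodic (mode (IZR n) z).
Proof.
  intros x. unfold mode. rewrite Rmult_plus_distr_l, expi_plus, expi_2PI_int. ring.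
Qed.

Lemma wave_smooth (n : Z) om z : smooth_on_RxT (wave (IZR n) om z).
Proof.
  split.
  - intros t. rewrite wave_slice. apply mode_periodic.
  - intros w t x. destruct (partial_wave w (IZR n) om z) as [z' E]. simpl. rewrite E.
    split; [|split].
    + eexists. apply is_derive_wave_t.
    + eexists. apply is_derive_wave_x.
    + apply wave_continuous.
Qed.

Lemma mode_smooth (n : Z) z : smooth_on_T (mode (IZR n) z).
Proof.
  split; [apply mode_periodic|].
  assert (E : forall j, exists z', Nat.iter j deriv (mode (IZR n) z) = mode (IZR n) z').
  { induction j as [|j [z' IH]]; [now exists z|].
    exists (Ci * RtoC (IZR n) * z')%C. simpl. rewrite IH.
    extensionality x. apply deriv_unique, is_derive_mode. }
  intros j x. destruct (E j) as [z' ->]. eexists. apply is_derive_mode.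
Qed.

Lemma mean_const (c : R) : mean (fun _ => c) = c.
Proof. unfold mean. rewrite RInt_const_R. pose proof two_pi_pos. field; lra. Qed.

(** The time frequency of the plane wave of wave number [k] and amplitude [z]; its
    dependence on [|z|] is what separates nearby data. *)
Definition dispersion sgn k (z : C) : R := k ^ 3 - sgn * k * Cmod z ^ 2.

Lemma wave_solves sgn k z : mKdV2 sgn (wave k (dispersion sgn k z) z).
Proof.
  intros t x. set (om := dispersion sgn k z).
  rewrite dt_wave, !dx_wave.
  assert (HC : forall y, Cmod (wave k om z t y) = Cmod z).
  { intros y. unfold wave. rewrite Cmod_mult, Cmod_expi. ring. }
  rewrite (mean_ext _ (fun _ => Cmod z ^ 2)), mean_const by (intros y; now rewrite HC).
  rewrite (mean_ext _ (fun _ => k * Cmod z ^ 2)), mean_const, HC.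
  - unfold wave. unfold om at 1, dispersion.
    generalize (expi (k * x + om * t)) (Cmod z ^ 2). intros [e1 e2] m. destruct z as [p q].
    apply injective_projections; simpl; ring.
  - intros y. rewrite <- (HC y), Cmod_sq. unfold wave.
    generalize (expi (k * y + om * t)). intros [e1 e2]. destruct z as [p q]. simpl. ring.
Qed.

Lemma wave_global_solution sgn (n : Z) z :
  smooth_global_solution sgn (mode (IZR n) z) (wave (IZR n) (dispersion sgn (IZR n) z) z).
Proof.
  split; [apply wave_smooth|split; [apply wave_solves|]].
  intros x. rewrite wave_slice, Rmult_0_r. unfold expi. rewrite cos_0, sin_0.
  change (1, 0) with (RtoC 1). now rewrite Cmult_1_r.
Qed.

Lemma solution_map_mode sgn (n : Z) z :
  sgn = 1 \/ sgn = -1 ->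
  solution_map sgn (mode (IZR n) z) = wave (IZR n) (dispersion sgn (IZR n) z) z.
Proof.
  intros Hsgn. apply (smooth_global_solution_unique sgn (mode (IZR n) z)); auto.
  - exact (epsilon_spec (inhabits (fun _ _ => RtoC 0))
             (smooth_global_solution sgn (mode (IZR n) z))
             (ex_intro _ _ (wave_global_solution sgn n z))).
  - apply wave_global_solution.
Qed.

(** * Norms of single modes *)

Lemma RInt_mode_zero (m : Z) (z : C) :
  m <> 0%Z -> is_RInt (V := C_R_NormedModule) (mode (IZR m) z) 0 (2 * PI) (RtoC 0).
Proof.
  intros Hm. assert (Hk : IZR m <> 0) by now apply not_0_IZR.
  set (z' := (z / (Ci * RtoC (IZR m)))%C).
  assert (Hz : (Ci * RtoC (IZR m) * z')%C = z).
  { unfold z'. field. split.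
    - intros H. apply Hk. now apply RtoC_inj.
    - intros H. apply (f_equal snd) in H. simpl in H. lra. }
  replace (RtoC 0) with (minus (G := C_R_NormedModule) (mode (IZR m) z' (2 * PI)) (mode (IZR m) z' 0)).
  - apply (is_RInt_derive (V := C_R_CompleteNormedModule)).
    + intros x _. rewrite <- Hz. apply is_derive_mode.
    + intros x _. apply (ex_derive_continuous (V := C_R_NormedModule)).
      eexists. apply is_derive_mode.
  - rewrite <- (Rplus_0_l (2 * PI)), mode_periodic. apply (minus_eq_zero (G := C_R_NormedModule)).
Qed.

Lemma fourier_mode (m n : Z) (z : C) :
  fourier (mode (IZR m) z) n = if Z.eq_dec n m then z else RtoC 0.
Proof.
  unfold fourier. pose proof two_pi_pos as HL.
  rewrite (RInt_ext (V := C_R_CompleteNormedModule) _ (mode (IZR (m - n)) z)).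
  2: { intros x _. unfold mode. rewrite <- Cmult_assoc, <- expi_plus, minus_IZR.
       do 2 f_equal. ring. }
  destruct (Z.eq_dec n m) as [->|Hn].
  - rewrite (RInt_ext (V := C_R_CompleteNormedModule) _ (fun _ => z)).
    2: { intros x _. unfold mode, expi. rewrite Z.sub_diag, Rmult_0_l, cos_0, sin_0.
         change (z * RtoC 1 = z)%C. ring. }
    rewrite (RInt_const (V := C_R_CompleteNormedModule)), Rminus_0_r.
    destruct z as [p q]. apply injective_projections; simpl;
      unfold scal; simpl; unfold mult; simpl; field; apply Rgt_not_eq, PI_RGT_0.
  - rewrite (is_RInt_unique (V := C_R_CompleteNormedModule) _ _ _ (RtoC 0)).
    + ring.
    + apply RInt_mode_zero. lia.
Qed.

Lemma sum_n_spike (f : nat -> R) (j : nat) :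
  (forall k, k <> j -> f k = 0) ->
  forall M, sum_n f M = if le_dec j M then f j else 0.
Proof.
  intros Hf. induction M as [|M IH].
  - rewrite sum_O. destruct (le_dec j 0) as [H|H].
    + now replace j with 0%nat by lia.
    + apply Hf. lia.
  - rewrite sum_Sn, IH. unfold plus; simpl.
    destruct (le_dec j M), (le_dec j (S M)); try lia.
    + rewrite (Hf (S M)) by lia. ring.
    + replace (S M) with j by lia. ring.
    + rewrite (Hf (S M)) by lia. ring.
Qed.

Lemma sumZ_spike (a : Z -> R) (j : nat) :
  (forall n, n <> Z.of_nat j -> a n = 0) -> sumZ a = Finite (a (Z.of_nat j)).
Proof.
  intros Ha. unfold sumZ.
  rewrite (Lim_seq_ext_loc _ (fun _ => a (Z.of_nat j))); [apply Lim_seq_const|].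
  exists j. intros M HM.
  rewrite (sum_n_spike (fun k => a (Z.of_nat k)) j) by (intros k Hk; apply Ha; lia).
  rewrite (sum_n_spike (fun k => a (- Z.of_nat (S k))%Z) 0)
    by (intros k Hk; apply Ha; lia).
  destruct (le_dec j M); [|lia]. destruct (le_dec 0 M); [|lia].
  rewrite (Ha (- Z.of_nat 1)%Z) by lia. ring.
Qed.

Lemma rpow_inv (x p : R) : 0 <= x -> 0 < p -> rpow (rpow x p) (/ p) = x.
Proof.
  intros Hx Hp. unfold rpow. destruct (Req_EM_T x 0) as [->|Hx0].
  - destruct (Req_EM_T 0 0); [reflexivity|lra].
  - destruct (Req_EM_T (Rpower x p) 0) as [H|_].
    + pose proof (exp_pos (p * ln x)). unfold Rpower in H. lra.
    + rewrite Rpower_mult, Rinv_r by lra. apply Rpower_1. lra.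
Qed.

Lemma lp_norm_spike (p : R) (a : Z -> R) (j : nat) :
  0 < p -> (forall n, n <> Z.of_nat j -> a n = 0) ->
  lp_norm p a = Finite (Rabs (a (Z.of_nat j))).
Proof.
  intros Hp Ha. unfold lp_norm.
  rewrite (sumZ_spike _ j).
  - now rewrite rpow_inv by auto using Rabs_pos.
  - intros n Hn. rewrite Ha, Rabs_R0 by exact Hn. unfold rpow.
    destruct (Req_EM_T 0 0); [reflexivity|lra].
Qed.

Lemma FL_norm_mode (s p : R) (j : nat) (z : C) :
  0 < p ->
  FL_norm s p (mode (IZR (Z.of_nat j)) z) =
  Finite (Rpower (japanese (Z.of_nat j)) s * Cmod z).
Proof.
  intros Hp. unfold FL_norm.
  rewrite (lp_norm_spike p _ j Hp).
  - rewrite fourier_mode. destruct (Z.eq_dec (Z.of_nat j) (Z.of_nat j)); [|easy].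
    rewrite Rabs_pos_eq; [reflexivity|].
    apply Rmult_le_pos; [apply Rlt_le, exp_pos|apply Cmod_ge_0].
  - intros n Hn. rewrite fourier_mode. destruct (Z.eq_dec n (Z.of_nat j)); [easy|].
    rewrite Cmod_0. ring.
Qed.

Lemma FL_dist_mode (s p : R) (j : nat) (z z' : C) :
  0 < p ->
  FL_dist s p (mode (IZR (Z.of_nat j)) z) (mode (IZR (Z.of_nat j)) z') =
  Finite (Rpower (japanese (Z.of_nat j)) s * Cmod (z - z')%C).
Proof.
  intros Hp. unfold FL_dist. rewrite <- (FL_norm_mode s p j (z - z')%C Hp).
  f_equal. extensionality x. unfold mode. ring.
Qed.

Lemma CFL_dist_ge T s p u v t :
  - T <= t <= T -> Rbar_le (FL_dist s p (u t) (v t)) (CFL_dist T s p u v).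
Proof.
  intros Ht. unfold CFL_dist, Rbar_lub.
  destruct (Rbar_ex_lub _) as [l [Hl Hl2]]. simpl. apply Hl. now exists t.
Qed.

(** * Growth of the phase speed and conclusion *)

(** Since [j <= <j> <= 2 j], the product is at least [j^{1-2s} / 2], with a
    positive exponent. *)
Lemma frequency_growth (s A : R) :
  s < 1 / 2 ->
  exists j : nat, (1 <= j)%nat /\
    A < INR j * Rpower (japanese (Z.of_nat j)) (- (2 * s)).
Proof.
  intros Hs. set (e := 1 - 2 * s). assert (He : 0 < e) by (unfold e; lra).
  set (A' := Rmax A 1).
  assert (HA : A <= A') by apply Rmax_l. assert (HA' : 1 <= A') by apply Rmax_r.
  destruct (nfloor_ex (Rpower (2 * A') (/ e))) as [n [_ Hn]].
  { apply Rlt_le, exp_pos. }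
  exists (S n). split; [lia|].
  rewrite S_INR.
  assert (Hj1 : 1 <= INR n + 1) by (pose proof (pos_INR n); lra).
  set (x := INR n + 1) in *.
  assert (HJ : japanese (Z.of_nat (S n)) = sqrt (1 + x ^ 2)).
  { unfold japanese, x. now rewrite <- INR_IZR_INZ, S_INR. }
  rewrite HJ. set (J := sqrt (1 + x ^ 2)).
  assert (HJ1 : x <= J).
  { unfold J. rewrite <- (sqrt_pow2 x) at 1 by lra. apply sqrt_le_1; nra. }
  assert (HJ2 : J <= 2 * x).
  { unfold J. rewrite <- (sqrt_pow2 (2 * x)) by lra. apply sqrt_le_1; nra. }
  assert (HP : 2 * A' < Rpower J e).
  { apply Rlt_le_trans with (Rpower x e).
    - replace (2 * A') with (Rpower (Rpower (2 * A') (/ e)) e).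
      + apply Rlt_Rpower_l; [exact He|]. split; [apply exp_pos|exact Hn].
      + rewrite Rpower_mult, Rinv_l by lra. apply Rpower_1. lra.
    - apply Rle_Rpower_l; [lra|]. split; lra. }
  assert (HE : Rpower J e = J * Rpower J (- (2 * s))).
  { rewrite <- (Rpower_1 J) at 2 by lra. rewrite <- Rpower_plus. reflexivity. }
  pose proof (exp_pos (- (2 * s) * ln J)) as Hq. fold (Rpower J (- (2 * s))) in Hq.
  nra.
Qed.

Theorem proposition1p8 :
  forall s p sgn : R,
    s < 1 / 2 -> 1 <= p -> (sgn = 1 \/ sgn = -1) ->
    fails_locally_uniformly_continuous s p (solution_map sgn).
Proof.
  intros s p sgn Hs Hp Hsgn T HT.
  assert (Hp0 : 0 < p) by lra.
  exists (fun f => exists (j : nat) (z : C), f = mode (IZR (Z.of_nat j)) z /\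
             Rpower (japanese (Z.of_nat j)) s * Cmod z <= 2).
  split; [|split].
  - intros f (j & z & -> & _). apply mode_smooth.
  - exists 2. intros f (j & z & -> & Hz). now rewrite FL_norm_mode.
  - intros HU. destruct (HU 1 Rlt_0_1) as (delta & Hd & HUd). clear HU.
    pose proof PI_RGT_0 as HPI.
    (* The minimum with 1 keeps q below 2, so that both data lie in the ball. *)
    set (d := Rmin delta 1).
    assert (Hd0 : 0 < d) by (apply Rmin_glb_lt; lra).
    destruct (frequency_growth s (PI / (T * d)) Hs) as (j & Hj & Hgrow).
    set (k := INR j) in *. set (J := japanese (Z.of_nat j)) in *.
    assert (Hk : 1 <= k) by (apply (le_INR 1) in Hj; exact Hj).
    set (r := Rpower J (- s)).
    assert (Hr : 0 < r) by apply exp_pos.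
    assert (Hr2 : Rpower J (- (2 * s)) = r ^ 2).
    { unfold r. simpl. rewrite Rmult_1_r, <- Rpower_plus. f_equal. lra. }
    assert (Hsr : Rpower J s * r = 1).
    { unfold r. rewrite <- Rpower_plus, Rplus_opp_r. apply Rpower_O.
      unfold J, japanese. apply sqrt_lt_R0. pose proof (pow2_ge_0 (IZR (Z.of_nat j))). lra. }
    rewrite Hr2 in Hgrow.
    assert (Hkr : 0 < k * r ^ 2) by (apply Rmult_lt_0_compat; [lra|now apply pow_lt]).
    (* This value of eta makes the phases differ by exactly PI at time T. *)
    set (eta := PI / (T * (k * r ^ 2))).
    assert (Heta : eta * (T * (k * r ^ 2)) = PI) by (unfold eta; field; nra).
    assert (Heta0 : 0 < eta) by (apply Rdiv_lt_0_compat; [lra|nra]).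
    assert (Hetad : eta < d).
    { apply (Rmult_lt_compat_r (T * d)) in Hgrow; [|nra].
      replace (PI / (T * d) * (T * d)) with PI in Hgrow by (field; nra).
      rewrite <- Heta in Hgrow. apply (Rmult_lt_reg_r (T * (k * r ^ 2))); nra. }
    assert (Hdd : d <= delta /\ d <= 1) by (split; [apply Rmin_l|apply Rmin_r]).
    set (q := sqrt (1 + eta)).
    assert (Hq2 : q ^ 2 = 1 + eta) by (unfold q; rewrite pow2_sqrt; lra).
    assert (Hq0 : 0 <= q) by apply sqrt_pos.
    assert (Hq1 : 1 < q) by nra.
    assert (Hqe : q - 1 < eta) by nra.
    set (z1 := RtoC r). set (z2 := RtoC (r * q)).
    assert (Hz1 : Cmod z1 = r) by (unfold z1; rewrite Cmod_R, Rabs_pos_eq; lra).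
    assert (Hz2 : Cmod z2 = r * q) by (unfold z2; rewrite Cmod_R, Rabs_pos_eq; nra).
    (* Equal wave numbers, amplitudes in ratio q close to 1. *)
    specialize (HUd (mode (IZR (Z.of_nat j)) z1) (mode (IZR (Z.of_nat j)) z2)).
    rewrite !solution_map_mode in HUd by exact Hsgn.
    rewrite FL_dist_mode in HUd by exact Hp0.
    assert (Hlt : Rbar_lt (CFL_dist T s p
        (wave (IZR (Z.of_nat j)) (dispersion sgn (IZR (Z.of_nat j)) z1) z1)
        (wave (IZR (Z.of_nat j)) (dispersion sgn (IZR (Z.of_nat j)) z2) z2)) 1).
    { apply HUd.
      - exists j, z1. split; [reflexivity|]. fold J. rewrite Hz1, Hsr. lra.
      - exists j, z2. split; [reflexivity|]. fold J.
        rewrite Hz2, <- Rmult_assoc, Hsr. nra.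
      - simpl. fold J. unfold z1, z2. rewrite <- RtoC_minus, Cmod_R.
        rewrite Rabs_minus_sym, Rabs_pos_eq by nra.
        replace (Rpower J s * (r * q - r)) with (Rpower J s * r * (q - 1)) by ring.
        rewrite Hsr. lra. }
    assert (Hge := CFL_dist_ge T s p
        (wave (IZR (Z.of_nat j)) (dispersion sgn (IZR (Z.of_nat j)) z1) z1)
        (wave (IZR (Z.of_nat j)) (dispersion sgn (IZR (Z.of_nat j)) z2) z2) T
        ltac:(lra)).
    apply (Rbar_lt_not_le _ _ Hlt). eapply Rbar_le_trans; [|exact Hge].
    rewrite !wave_slice, FL_dist_mode by exact Hp0. fold J. simpl.
    set (o1 := dispersion sgn (IZR (Z.of_nat j)) z1).
    set (o2 := dispersion sgn (IZR (Z.of_nat j)) z2).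
    assert (Hphase : o1 * T = o2 * T + sgn * PI).
    { unfold o1, o2, dispersion. rewrite Hz1, Hz2, <- INR_IZR_INZ. fold k.
      rewrite <- Heta. replace ((r * q) ^ 2) with (r ^ 2 * q ^ 2) by ring.
      rewrite Hq2. ring. }
    assert (Hanti : expi (sgn * PI) = RtoC (-1)).
    { unfold expi, RtoC. destruct Hsgn as [-> | ->].
      - rewrite Rmult_1_l, cos_PI, sin_PI. reflexivity.
      - replace (-1 * PI) with (- PI) by ring.
        rewrite cos_neg, sin_neg, cos_PI, sin_PI, Ropp_0. reflexivity. }
    rewrite Hphase, expi_plus, Hanti.
    replace (z1 * (expi (o2 * T) * RtoC (-1)) - z2 * expi (o2 * T))%C
      with (RtoC (- (r + r * q)) * expi (o2 * T))%C.
    + rewrite Cmod_mult, Cmod_expi, Cmod_R, Rabs_Ropp, Rabs_pos_eq by nra.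
      replace (Rpower J s * ((r + r * q) * 1)) with (Rpower J s * r * (1 + q)) by ring.
      rewrite Hsr. lra.
    + unfold z1, z2. generalize (expi (o2 * T)). intros [e1 e2].
      apply injective_projections; simpl; ring.
Qed.
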